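(* Let $\mathbb K$ be a subfield of $\overline{\mathbb F}_p$. Given a non-commutative formal power series $A\in\mathfrak m\subset\mathbb K\langle\!\langle X_1,\dots,X_k\rangle\!\rangle$, the following two assertions are equivalent: (i) $A$ is rational. (ii) ${\exp}_!(A)$ is rational. More precisely, we have for a rational series $A$ in $\mathfrak m$ the inequalities $$\dim\left(\overline{{\log}_!(1+A)}\right)\leq1+\left(\dim(\overline{1+A})\right)^p$$ and $$\dim\left(\overline{{\exp}_!(A)}\right)\leq p^{q^{\dim(\overline{A})}}$$ where $q=p^e$ is the cardinality of a finite field $\mathbb F_q$ containing all coefficients of $A$.
   Context: $\mathbb K\langle\!\langle X_1,\dots,X_k\rangle\!\rangle$ denotes formal power series $A=\sum_{\mathbf X\in\mathcal X^*}(A,\mathbf X)\mathbf X$ in non-commuting variables, $\mathcal X^*$ the free monoid on $\{X_1,\dots,X_k\}$, and $\mathfrak m$ the ideal of series without constant term. The shuffle product of monomials is defined recursively by $\mathbf X\sqcup\!\sqcup1=1\sqcup\!\sqcup\mathbf X=\mathbf X$ and $(\mathbf XX_s)\sqcup\!\sqcup(\mathbf X'X_t)=(\mathbf X\sqcup\!\sqcup(\mathbf X'X_t))X_s+((\mathbf XX_s)\sqcup\!\sqcup\mathbf X')X_t$, extended bilinearly; $A^{\sqcup\!\sqcup^n}$ is the $n$-fold shuffle power. For $A\in\mathfrak m$, ${\exp}_!(A)=\sum_{n\ge0}\frac1{n!}A^{\sqcup\!\sqcup^n}$ (well-defined over any field since $A^{\sqcup\!\sqcup^n}/n!$ has integral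 coefficients), with reciprocal ${\log}_!(1+A)=\sum_{n\ge1}\frac{(-1)^{n+1}}nA^{\sqcup\!\sqcup^n}$. For a monomial $\mathbf T$, $\rho(\mathbf T)A=\sum_{\mathbf X}(A,\mathbf X\mathbf T)\mathbf X$; the recursive closure $\overline A$ is the span of $\{\rho(\mathbf T)A:\mathbf T\in\mathcal X^*\}$. A series is rational if it lies in the smallest subalgebra containing the non-commutative polynomials and closed under inversion of invertible elements; equivalently (Schützenberger) $\dim(\overline A)<\infty$. *)

(* Defs.v *)
From mathcomp Require Import all_boot all_order all_algebra all_field.
From mathcomp Require Import mpoly.

Set Implicit Arguments.
Unset Strict Implicit.
Unset Printing Implicit Defensive.

Import GRing.Theory.
Local Open Scope ring_scope.

Definition word (k : nat) := seq 'I_k.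

Definition series (R : Type) (k : nat) := word k -> R.

Section Series.
Variables (R : comNzRingType) (k : nat).
Implicit Types (A B : series R k) (w : word k).

Definition sone : series R k := fun w => (w == [::])%:R.

Definition sadd A B : series R k := fun w => A w + B w.

Definition ssub A B : series R k := fun w => A w - B w.

Definition sscale (c : R) A : series R k := fun w => c * A w.

Definition smul A B : series R k :=
  fun w => \sum_(i < (size w).+1) A (take i w) * B (drop i w).

Definition in_maxideal A : Prop := A [::] = 0.

Definition finite_support A : Prop :=
  exists s : seq (word k), forall w, w \notin s -> A w = 0.

Inductive rational : series R k -> Prop :=
| rational_poly A : finite_support A -> rational A
| rational_add A B : rational A -> rational B -> rational (sadd A B)
| rational_scale c A : rational A -> rational (sscale c A)
| rational_mul A B : rational A -> rational B -> rational (smul A B)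
| rational_inv A B :
    rational A -> smul A B =1 sone -> smul B A =1 sone -> rational B.

End Series.

Arguments sone {R k}.

(* The words of the shuffle product u ⧢ v, listed with multiplicity, with all  *)
(* words read from right to left.                                             *)
Fixpoint shuffle_rev (k : nat) (u : word k) : word k -> seq (word k) :=
  fix shuffle_u (v : word k) : seq (word k) :=
    match u, v with
    | [::], _ => [:: v]
    | _, [::] => [:: u]
    | s :: u', t :: v' =>
        [seq s :: w | w <- shuffle_rev u' v] ++ [seq t :: w | w <- shuffle_u v']
    end.

Definition shuffle (k : nat) (u v : word k) : seq (word k) :=
  [seq rev w | w <- shuffle_rev (rev u) (rev v)].

Lemma shuffle0w k (v : word k) : shuffle [::] v = [:: v].
Proof. by rewrite /shuffle; case: (rev v) (revK v) => [|a l] /= ->. Qed.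

Lemma shufflew0 k (u : word k) : shuffle u [::] = [:: u].
Proof. by rewrite /shuffle; case: (rev u) (revK u) => [|a l] /= ->. Qed.

Lemma shuffle_rcons k (u v : word k) (s t : 'I_k) :
  shuffle (rcons u s) (rcons v t) =
    [seq rcons w s | w <- shuffle u (rcons v t)]
      ++ [seq rcons w t | w <- shuffle (rcons u s) v].
Proof.
rewrite /shuffle !rev_rcons /= map_cat -!map_comp.
by congr (_ ++ _); apply: eq_map => w /=; rewrite rev_cons.
Qed.

Section Shuffle.
Variables (R : comNzRingType) (k : nat).
Implicit Types (A B : series R k).

(* The words of u ⧢ v have length |u| + |v|, so only words u and v of length   *)
(* at most |w| contribute to the coefficient of w.                            *)
Definition sh A B : series R k := fun w =>
  \sum_(u : (size w).-bseq 'I_k) \sum_(v : (size w).-bseq 'I_k)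
    A u * B v *+ count_mem w (shuffle u v).

Definition sh_pow n A : series R k := iter n (sh A) sone.

End Shuffle.

(* The generic series without constant term, truncated at length L: the       *)
(* coefficient of a word u with 0 < |u| <= L is an indeterminate a_u.          *)
Definition generic_series (k L : nat) :
    series {mpoly int[#|{: L.-bseq 'I_k}|]} k :=
  fun w => if w is [::] then 0 else oapp (fun u => 'X_(enum_rank u)) 0 (insub w).

Arguments generic_series : clear implicits.

(* The pairs (u, v) such that the word w is a shuffle of u and v, with        *)
(* multiplicity, all words read from right to left.                           *)
Fixpoint unshuffle_rev (k : nat) (w : word k) : seq (word k * word k) :=
  if w is s :: w' then
    [seq (s :: x.1, x.2) | x <- unshuffle_rev w']
      ++ [seq (x.1, s :: x.2) | x <- unshuffle_rev w']
  else [:: ([::], [::])].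

Lemma size_unshuffle_rev k (w : word k) x :
  x \in unshuffle_rev w -> (size x.1 <= size w)%N && (size x.2 <= size w)%N.
Proof.
elim: w x => [|s w IHw] x /=; first by rewrite inE => /eqP->.
rewrite mem_cat => /orP[] /mapP[y /IHw/andP[y1 y2] ->] /=.
  by rewrite ltnS y1 leqW.
by rewrite ltnS y2 leqW.
Qed.

Lemma count_map_inj (T U : eqType) (f : T -> U) (s : seq T) x :
  injective f -> count_mem (f x) (map f s) = count_mem x s.
Proof.
by move=> fI; rewrite count_map; apply: eq_count => y /=; rewrite (inj_eq fI).
Qed.

Lemma count_map_out (T U : eqType) (f : T -> U) (s : seq T) y :
  (forall x, f x != y) -> count_mem y (map f s) = 0%N.
Proof.
by move=> fy; rewrite count_map; elim: s => //= x s ->; rewrite (negbTE (fy x)).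
Qed.

Lemma count_shuffle_rev k (w u v : word k) :
  count_mem w (shuffle_rev u v) = count_mem (u, v) (unshuffle_rev w).
Proof.
have consE a b (x y : word k) : (a :: x == b :: y) = (a == b) && (x == y).
  by [].
have consI (a : 'I_k) : injective (cons a) by move=> x y [].
have lI (a : 'I_k) : injective (fun x : word k * word k => (a :: x.1, x.2)).
  by move=> [x1 x2] [y1 y2] /= [-> ->].
have rI (a : 'I_k) : injective (fun x : word k * word k => (x.1, a :: x.2)).
  by move=> [x1 x2] [y1 y2] /= [-> ->].
elim: w u v => [|s w IHw] [|a u] [|b v] //=.
- by rewrite count_cat !count_map_out.
- by rewrite count_cat count_map_out // count_map_out // => x; rewrite xpair_eqE andbF.
- rewrite count_cat count_map_out // addn0. rewrite consE.
  case: (eqVneq b s) => [->|bs] /=.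
    rewrite (count_map_inj (unshuffle_rev w) ([::], v) (rI s)) -IHw.
    by case: (v) => [|? ?] /=; rewrite addn0.
  by rewrite count_map_out // => -[x y] /=; apply: contraNneq bs => -[_ ->].
- rewrite count_cat [X in _ = (_ + X)%N]count_map_out ?addn0 => [|x]; last by rewrite xpair_eqE andbF.
  rewrite consE.
  case: (eqVneq a s) => [->|bs] /=.
    rewrite (count_map_inj (unshuffle_rev w) (u, [::]) (lI s)) -IHw.
    by case: (u) => [|? ?] /=; rewrite addn0.
  by rewrite count_map_out // => -[x y] /=; apply: contraNneq bs => -[->].
- rewrite !count_cat; congr (_ + _)%N.
    case: (eqVneq a s) => [->|bs] /=.
      by rewrite (count_map_inj _ _ (consI s)) IHw
                 (count_map_inj _ (u, b :: v) (lI s)).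
    rewrite !count_map_out // => [[x y]|x] /=; apply: contraNneq bs; first by case=> ->.
    by case=> ->.
  case: (eqVneq b s) => [->|bs] /=.
    by rewrite (count_map_inj _ _ (consI s)) (IHw (a :: u) v)
               (count_map_inj _ (a :: u, v) (rI s)).
  rewrite !count_map_out // => [[x y]|x] /=; apply: contraNneq bs; first by case=> _ ->.
  by case=> ->.
Qed.

Section ShuffleTheory.
Variables (R : comNzRingType) (k : nat).
Implicit Types (A B C : series R k) (w : word k).

Definition deriv_last (s : 'I_k) A : series R k := fun w => A (rcons w s).

Lemma sum_count L (F : word k -> word k -> R) (t : seq (word k * word k)) :
    (forall x, x \in t -> (size x.1 <= L)%N && (size x.2 <= L)%N) ->
  \sum_(u : L.-bseq 'I_k) \sum_(v : L.-bseq 'I_k)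
     F u v *+ count_mem (val u, val v) t = \sum_(x <- t) F x.1 x.2.
Proof.
elim: t => [|[u0 v0] t IHt] tL.
  by rewrite big_nil; apply: big1 => u _; apply: big1.
rewrite big_cons -IHt => [|x xt]; last by apply: tL; rewrite inE xt orbT.
have /andP[/= u0L v0L] := tL _ (mem_head _ _).
under eq_bigr => u _ do under eq_bigr => v _ do rewrite /= mulrnDr.
under eq_bigr => u _ do rewrite big_split.
rewrite big_split /=; congr (_ + _).
rewrite (bigD1 (Bseq u0L)) //= (bigD1 (Bseq v0L)) //= eqxx mulr1n.
rewrite [X in _ + X + _]big1 => [|v vP].
  rewrite addr0 [X in _ + X]big1 ?addr0 // => u uP; apply: big1 => v _.
  rewrite xpair_eqE; case: eqP => // uE; case/eqP: uP; exact/val_inj.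
rewrite xpair_eqE eqxx; case: eqP => // uE; case/eqP: vP; exact/val_inj.
Qed.

Lemma shE A B w :
  sh A B w = \sum_(x <- unshuffle_rev (rev w)) A (rev x.1) * B (rev x.2).
Proof.
have revI : injective (@rev 'I_k) by apply: can_inj (@revK _).
pose f (x : word k * word k) := (rev x.1, rev x.2).
have fK : involutive f by case=> x y; rewrite /f /= !revK.
rewrite -[RHS](big_map f xpredT (fun x => A x.1 * B x.2)).
rewrite -(@sum_count (size w) (fun u v => A u * B v)) => [|x].
  apply: eq_bigr => u _; apply: eq_bigr => v _; congr (_ *+ _).
  have shE (x y : word k) :
      count_mem w (shuffle x y) = count_mem (x, y) (map f (unshuffle_rev (rev w))).
    rewrite /shuffle -[w in LHS]revK (count_map_inj _ _ revI) count_shuffle_rev.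
    by rewrite -[LHS](count_map_inj _ _ (inv_inj fK)) /f /= !revK.
  exact: shE.
by case/mapP => y /size_unshuffle_rev; rewrite !size_rev => ? ->; rewrite !size_rev.
Qed.

Lemma sh_nil A B : sh A B [::] = A [::] * B [::].
Proof. by rewrite shE big_seq1. Qed.

Lemma sh_rcons A B w s :
  sh A B (rcons w s) = sh (deriv_last s A) B w + sh A (deriv_last s B) w.
Proof.
rewrite !shE rev_rcons /= big_cat !big_map /=; congr (_ + _).
  by apply: eq_bigr => x _; rewrite rev_cons.
by apply: eq_bigr => x _; rewrite rev_cons.
Qed.

Lemma eq_sh A A' B B' : A =1 A' -> B =1 B' -> sh A B =1 sh A' B'.
Proof. by move=> eA eB w; rewrite !shE; apply: eq_bigr => x _; rewrite eA eB. Qed.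

Lemma shC A B : sh A B =1 sh B A.
Proof.
move=> w; elim/last_ind: w A B => [|w s IHw] A B; first by rewrite !sh_nil mulrC.
by rewrite !sh_rcons (IHw A) IHw addrC.
Qed.

Lemma shDl A A' B w : sh (sadd A A') B w = sh A B w + sh A' B w.
Proof.
by rewrite !shE -big_split; apply: eq_bigr => x _; rewrite /sadd mulrDl.
Qed.

Lemma shDr A B B' w : sh A (sadd B B') w = sh A B w + sh A B' w.
Proof. by rewrite shC shDl !(shC A). Qed.

Lemma shMnr A B n w : sh A (fun v => B v *+ n) w = sh A B w *+ n.
Proof.
by rewrite !shE -sumrMnl; apply: eq_bigr => x _; rewrite mulrnAr.
Qed.

Lemma shA A B C : sh A (sh B C) =1 sh (sh A B) C.
Proof.
move=> w; elim/last_ind: w A B C => [|w s IHw] A B C.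
  by rewrite !sh_nil mulrA.
rewrite !sh_rcons.
have -> : sh A (deriv_last s (sh B C)) w =
    sh A (sadd (sh (deriv_last s B) C) (sh B (deriv_last s C))) w.
  exact: eq_sh (frefl A) (sh_rcons B C ^~ s) w.
have -> : sh (deriv_last s (sh A B)) C w =
    sh (sadd (sh (deriv_last s A) B) (sh A (deriv_last s B))) C w.
  exact: eq_sh (sh_rcons A B ^~ s) (frefl C) w.
by rewrite shDr shDl !IHw addrA.
Qed.

Lemma sh_pow_rcons n A w s :
  sh_pow n.+1 A (rcons w s) = sh (sh_pow n A) (deriv_last s A) w *+ n.+1.
Proof.
elim: n w => [|n IHn] w.
  rewrite [LHS]sh_rcons mulr1n shC [X in _ + X](_ : _ = 0) ?addr0 //.
  rewrite shE big1 // => x _; rewrite /deriv_last /sone.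
  by rewrite -size_eq0 size_rcons mulr0.
rewrite [LHS]sh_rcons.
have -> : sh A (deriv_last s (sh_pow n.+1 A)) w =
    sh A (fun v => sh (sh_pow n A) (deriv_last s A) v *+ n.+1) w.
  exact: eq_sh (frefl A) IHn w.
rewrite shMnr [X in _ + X *+ _]shA [RHS]mulrS; congr (_ + _); exact: shC.
Qed.

Lemma sh_pow_dvd n A w :
  in_maxideal A -> exists D, sh_pow n A w = D *+ n`!.
Proof.
move=> A0; have [m] := ubnP (size w); elim: m => // m IHm in w n *.
case: n => [|n]; first by exists (sh_pow 0 A w).
case/lastP: w => [|w s]; first by exists 0; rewrite mul0rn [LHS]sh_nil A0 mul0r.
rewrite size_rcons ltnS => wm; rewrite sh_pow_rcons shE big_seq.
suff [D ->] : exists D, \sum_(x <- unshuffle_rev (rev w) | x \in unshuffle_rev (rev w))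
   sh_pow n A (rev x.1) * deriv_last s A (rev x.2) = D *+ n`!.
  by exists D; rewrite -mulrnA mulnC.
apply: (big_ind (fun y => exists D, y = D *+ n`!)) => [|_ _ [D ->] [E ->]|x].
- by exists 0; rewrite mul0rn.
- by exists (D + E); rewrite mulrnDl.
case/size_unshuffle_rev/andP; rewrite size_rev => xw _.
have [|D ->] := IHm (rev x.1) n; first by rewrite size_rev (leq_ltn_trans xw).
by exists (D * deriv_last s A (rev x.2)); rewrite mulrnAl.
Qed.

End ShuffleTheory.

Lemma generic_sh_pow_dvd k L n (w : word k) m :
  (n`!%:Z %| (sh_pow n (generic_series k L) w)@_m)%Z.
Proof.
have [//|D ->] := @sh_pow_dvd _ _ n (generic_series k L) w.
by rewrite mcoeffMn -mulr_natr natz dvdz_mull.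
Qed.

Section ExpLog.
Variables (R : comNzRingType) (k : nat).
Implicit Types (A B : series R k).

(* The series (1/d) A^{⧢n} for A without constant term, when d divides n!: the *)
(* coefficient of w in the n-th shuffle power of the generic series is a       *)
(* polynomial in the a_u with integer coefficients, all divisible by n!        *)
(* (generic_sh_pow_dvd).  Divide them by d in the integers, and only then      *)
(* substitute A u for a_u (see sh_pow_divE).                                   *)
Definition sh_pow_div (n d : nat) A : series R k := fun w =>
  mmap (fun c : int => ((c %/ d)%Z)%:~R) (fun i => A (enum_val i : (size w).-bseq 'I_k))
       (sh_pow n (generic_series k (size w)) w).

(* For A without constant term A^{⧢n} vanishes on words of length < n, so the  *)
(* sum over all n >= 0 reduces at w to the terms with n <= |w|.                *)
Definition sh_exp A : series R k := fun w =>
  \sum_(0 <= n < (size w).+1) sh_pow_div n n`! A w.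

(* log_!(B) for B with constant term 1.                                        *)
Definition sh_log B : series R k := fun w =>
  \sum_(1 <= n < (size w).+1) (-1) ^+ n.+1 * sh_pow_div n n (ssub B sone) w.

End ExpLog.

Section ShPowDiv.
Variables (R : comNzRingType) (k : nat).

Lemma rmorph_sh (S : comNzRingType) (h : {rmorphism S -> R}) (A B : series S k) w :
  h (sh A B w) = sh (fun w => h (A w)) (fun w => h (B w)) w.
Proof. rewrite !shE raddf_sum; apply: eq_bigr => x _; exact: rmorphM. Qed.

Lemma sh_pow_local n (A B : series R k) w :
  (forall u, (size u <= size w)%N -> A u = B u) -> sh_pow n A w = sh_pow n B w.
Proof.
elim: n w => // n IH w e. rewrite [LHS]shE [RHS]shE; apply: eq_big_seq => x.
case/size_unshuffle_rev/andP; rewrite !size_rev => x1 x2.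
rewrite e ?size_rev //; congr (_ * _); apply: IH => u; rewrite size_rev => ul; apply: e; exact: leq_trans ul x2.
Qed.

Lemma sh_pow_divE n d (A : series R k) w : in_maxideal A -> (d %| n`!)%N ->
  sh_pow n A w = d%:R * sh_pow_div n d A w.
Proof.
move=> A0 dn; set L := size w.
pose ev i := A (enum_val (A := {: (size w).-bseq 'I_k}) i).
have d0 : (d > 0)%N by apply: dvdn_gt0 dn; apply: fact_gt0.
have -> : sh_pow n A w = mmap intr ev (sh_pow n (generic_series k L) w).
  transitivity (sh_pow n (fun u => mmap intr ev (generic_series k L u)) w).
    apply: sh_pow_local => -[|a u] ul; first by rewrite /= mmap0.
    by rewrite /= insubT /= mmapX mmap1U /ev enum_rankK.
  pose G := generic_series k L; rewrite -/G.
  have H n' w' : sh_pow n' (fun u => mmap intr ev (G u)) w' = mmap intr ev (sh_pow n' G w').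
    elim: n' w' => [|n' IH] w'; first by rewrite /sh_pow /= /sone; case: eqP; rewrite ?mmap1 ?rmorph1 ?rmorph0.
    rewrite [RHS](rmorph_sh (mmap intr ev)) [LHS]shE [RHS]shE; apply: eq_bigr => x _; congr (_ * _); exact: IH.
  exact: H.
rewrite /sh_pow_div /mmap mulr_sumr; apply: eq_bigr => m _.
rewrite mulrA; congr (_ * _).
have /dvdzP[q ->] := @generic_sh_pow_dvd k L n w m.
have /dvdnP[e ->] := dn.
rewrite PoszM mulrA mulzK; last by rewrite eqz_nat -lt0n.
by rewrite mulrC rmorphM /= -pmulrn.
Qed.

End ShPowDiv.

Section Dimension.
Variables (K : fieldType) (k : nat).
Implicit Types (A B : series K k).

Definition span (I : Type) (F : I -> series K k) (B : series K k) : Prop :=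
  exists s : seq (K * I), forall w, B w = \sum_(x <- s) x.1 * F x.2 w.

Definition rho (T : word k) A : series K k := fun w => A (w ++ T).

Definition rec_closure A : series K k -> Prop := span (rho^~ A).

Definition independent (d : nat) (b : 'I_d -> series K k) : Prop :=
  forall c : 'I_d -> K,
    (forall w, \sum_(i < d) c i * b i w = 0) -> forall i, c i = 0.

Definition has_dim (V : series K k -> Prop) (d : nat) : Prop :=
  exists b : 'I_d -> series K k,
    independent b /\ (forall B, V B <-> span b B).

End Dimension.

(* Main.v *)
(** In characteristic p the p-th shuffle power of a series B is the constant
    B(1)^p, because deleting the last letter is a derivation of the shuffle
    algebra and so kills p-th powers.  The derivation acts on exp_! and log_! by
    d(exp_! A) = exp_! A ⧢ dA and d(log_! B) = B^{⧢(p-1)} ⧢ dB.  Hence, if the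
    finite family b spans the recursive closure of A, respectively of B = 1 + A,
    then exp_! A times the monomials in the b_i with exponents < p,
    respectively log_! B together with the p-fold shuffle products of the b_i,
    span a space stable under deletion of the last letter.  This gives
    dim <= p^d <= p^(q^d) and dim <= 1 + d^p; rationality is
    finiteness of the dimension (Schützenberger), and log_!(exp_! A) = A because
    both sides have the same derivatives.  The coefficients of a rational series
    lie in a finitely generated subring of K, hence in {x | x^(p^e) = x}. *)

Require Import Defs.
From mathcomp Require Import all_boot all_order all_algebra all_field.
From mathcomp Require Import mpoly.
From HB Require Import structures.
From mathcomp Require Import boolp functions.

Set Implicit Arguments.
Unset Strict Implicit.
Unset Printing Implicit Defensive.

Import GRing.Theory.
Local Open Scope ring_scope.

(* Unqualified, span would be the span of vector.v. *)
Local Notation span := Defs.span.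

(** * The shuffle algebra *)

Lemma seriesP (R : Type) (k : nat) (A B : series R k) : A =1 B -> A = B.
Proof. by move=> eAB; apply/funext. Qed.

Lemma sh_local (R : comNzRingType) k (A A' B B' : series R k) w :
    (forall u, (size u <= size w)%N -> A u = A' u) ->
    (forall u, (size u <= size w)%N -> B u = B' u) ->
  sh A B w = sh A' B' w.
Proof.
move=> eA eB; rewrite !shE; apply: eq_big_seq => x.
by case/size_unshuffle_rev/andP; rewrite size_rev => x1 x2; rewrite eA ?eB ?size_rev.
Qed.

(** An alias of [series] carrying the shuffle product; the alias [conc] carries concatenation. *)
Definition shuf (R : comNzRingType) (k : nat) : Type := series R k.

Section ShuffleAlgebra.
Variables (R : comNzRingType) (k : nat).
Implicit Types (A B C : shuf R k) (w : word k) (s : 'I_k).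

HB.instance Definition _ := GRing.Lmodule.copy (shuf R k) (word k -> R^o).

Fact sh_mulC : commutative (@sh R k : shuf R k -> shuf R k -> shuf R k).
Proof. by move=> A B; apply: seriesP; apply: shC. Qed.

Fact sh_mulA : associative (@sh R k : shuf R k -> shuf R k -> shuf R k).
Proof. by move=> A B C; apply: seriesP; apply: shA. Qed.

Fact sh_mul1 : left_id (sone : shuf R k) (@sh R k).
Proof.
move=> A; apply: seriesP => w; elim/last_ind: w A => [|w s IHw] A.
  by rewrite sh_nil /sone eqxx mul1r.
rewrite sh_rcons IHw [X in X + _](_ : _ = 0) ?add0r // shE big1 // => x _.
by rewrite /deriv_last /sone -size_eq0 size_rcons mul0r.
Qed.

Fact sh_mulDl : left_distributive (@sh R k : shuf R k -> shuf R k -> shuf R k) +%R.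
Proof. by move=> A B C; apply: seriesP => w; apply: shDl. Qed.

Fact sh_one_neq0 : (sone : shuf R k) != 0.
Proof.
apply/eqP => /(congr1 (fun A : shuf R k => A [::])) /eqP.
by rewrite /sone eqxx (oner_eq0 R).
Qed.

HB.instance Definition _ := GRing.Zmodule_isComNzRing.Build (shuf R k)
  sh_mulA sh_mulC sh_mul1 sh_mulDl sh_one_neq0.

Fact sh_scaleAl (a : R) A B : a *: (A * B) = a *: A * B.
Proof.
apply: seriesP => w; rewrite [RHS]shE [LHS](congr1 (fun x => a * x) (shE _ _ _)).
by rewrite mulr_sumr; apply: eq_bigr => x _; rewrite mulrA.
Qed.

HB.instance Definition _ := GRing.Lmodule_isLalgebra.Build R (shuf R k) sh_scaleAl.
HB.instance Definition _ := GRing.Lalgebra_isComAlgebra.Build R (shuf R k).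

Lemma sh_powE n A : sh_pow n A = A ^+ n.
Proof. by elim: n => // n IHn; rewrite exprS -IHn. Qed.

Lemma shuf_sumE (I : Type) (r : seq I) (P : pred I) (F : I -> shuf R k) w :
  (\sum_(i <- r | P i) F i) w = \sum_(i <- r | P i) F i w.
Proof. exact: (big_morph (fun A : shuf R k => A w)). Qed.

Definition dlast s A : shuf R k := deriv_last s A.

Fact dlast_linear s : linear (dlast s).
Proof. by []. Qed.

HB.instance Definition _ s :=
  GRing.isLinear.Build R (shuf R k) (shuf R k) _ (dlast s) (dlast_linear s).

Lemma dlastM s A B : dlast s (A * B) = dlast s A * B + A * dlast s B.
Proof. by apply: seriesP => w; apply: sh_rcons. Qed.

Lemma dlast1 s : dlast s 1 = 0.
Proof. by apply: seriesP => w; rewrite /dlast /deriv_last; case: w. Qed.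

Lemma dlastX s A n : dlast s (A ^+ n) = A ^+ n.-1 * dlast s A *+ n.
Proof.
elim: n => [|n IHn]; first by rewrite expr0 dlast1.
rewrite exprS dlastM IHn mulrnAr mulrA -exprS mulrC.
by case: n {IHn} => [|n]; rewrite ?mulr0n ?addr0 //= -mulrS.
Qed.

Lemma shuf_mulrnE A n w : (A *+ n) w = A w *+ n.
Proof. by elim: n => // n IHn; rewrite !mulrS -IHn. Qed.

(** A nonempty word has a last letter, so this is the uniqueness principle for identities proved by
    differentiation. *)
Lemma dlast_eq A B : A [::] = B [::] -> (forall s, dlast s A = dlast s B) -> A = B.
Proof.
move=> e0 eD; apply: seriesP => w; case/lastP: w => // w s.
exact: (congr1 (fun C : shuf R k => C w) (eD s)).
Qed.

Lemma sh_mul_nil A B : (A * B) [::] = A [::] * B [::] :> R.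
Proof. exact: sh_nil. Qed.

Lemma shX_nil A n : (A ^+ n) [::] = A [::] ^+ n :> R.
Proof. by elim: n => [|n IHn] //; rewrite !exprS sh_mul_nil IHn. Qed.

(** The derivative of A^(n+1) is a multiple of A^n dA, and a shuffle product at [w] only sees words
    no longer than [w]. *)
Lemma shX_small A n w : A [::] = 0 -> (size w < n)%N -> (A ^+ n) w = 0.
Proof.
move=> A0; elim: n w => // n IHn w; rewrite ltnS => wn.
case/lastP: w wn => [|w s] wn.
  by rewrite shX_nil A0 expr0n.
have -> : (A ^+ n.+1) (rcons w s) = dlast s (A ^+ n.+1) w by [].
rewrite size_rcons in wn.
rewrite dlastX /= shuf_mulrnE.
have -> : (A ^+ n * dlast s A) w = (0 * dlast s A) w.
  apply: sh_local => // u uw; apply: IHn; exact: leq_ltn_trans wn.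
by rewrite mul0r mul0rn.
Qed.

End ShuffleAlgebra.

(** * Divided shuffle powers *)

Section DividedPowers.
Variables (R : comNzRingType) (k : nat).
Implicit Types (A B : series R k) (w : word k).

Lemma rmorph_sh_pow (S : comNzRingType) (h : {rmorphism S -> R}) n
    (G : series S k) w :
  h (sh_pow n G w) = sh_pow n (fun u => h (G u)) w.
Proof.
elim: n w => [|n IHn] w; first by rewrite /= /sone rmorph_nat.
rewrite [LHS](rmorph_sh h G (sh_pow n G)); apply: sh_local => // u _; exact: IHn.
Qed.

Lemma rmorph_sh_pow_div (S : comNzRingType) (h : {rmorphism S -> R}) n d
    (G : series S k) w :
  h (sh_pow_div n d G w) = sh_pow_div n d (fun u => h (G u)) w.
Proof.
rewrite /sh_pow_div /mmap rmorph_sum; apply: eq_bigr => m _.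
rewrite rmorphM /= rmorph_int /mmap1 rmorph_prod; congr (_ * _).
by apply: eq_bigr => i _; rewrite rmorphXn.
Qed.

Lemma sh_pow_div_local n d A B w :
  (forall u, (size u <= size w)%N -> A u = B u) ->
  sh_pow_div n d A w = sh_pow_div n d B w.
Proof.
move=> eAB; apply: eq_bigr => m _; congr (_ * _).
by apply: eq_bigr => i _; congr (_ ^+ _); apply/eAB/size_bseq.
Qed.

Definition torsion_free (S : comNzRingType) :=
  forall (x : S) d, (0 < d)%N -> x *+ d = 0 -> x = 0.

(** Without torsion the quotient by d is unique, and [sh_pow_div] commutes with ring morphisms. A
    quotient found over integer polynomials therefore specialises to R, where d may be zero. *)
Lemma sh_pow_div_lift (S : comNzRingType) (h : {rmorphism S -> R}) n d
    (G : series S k) A w D :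
    torsion_free S -> in_maxideal G -> (d %| n`!)%N ->
    (forall u, (size u <= size w)%N -> h (G u) = A u) ->
  sh_pow n G w = D *+ d -> sh_pow_div n d A w = h D.
Proof.
move=> tfS G0 dn eGA e.
have d0 : (0 < d)%N by apply: dvdn_gt0 dn; apply: fact_gt0.
have -> : D = sh_pow_div n d G w.
  apply/eqP; rewrite -subr_eq0; apply/eqP/(tfS _ d) => //.
  by rewrite mulrnBl -e (sh_pow_divE w G0 dn) mulr_natl subrr.
by rewrite rmorph_sh_pow_div; apply: sh_pow_div_local => u /eGA.
Qed.

Lemma mpoly_int_torsion_free n : torsion_free {mpoly int[n]}.
Proof.
move=> x d d0 /mpolyP e; apply/mpolyP => m; move: (e m).
by rewrite mcoeffMn mcoeff0 => /eqP; rewrite Num.Theory.mulrn_eq0 gtn_eqF //= => /eqP.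
Qed.

Definition generic_eval L A :=
  mmap (intr : int -> R) (fun i => A (enum_val (A := {: L.-bseq 'I_k}) i)).

Arguments generic_eval : clear implicits.

Lemma generic_evalE L A u : in_maxideal A -> (size u <= L)%N ->
  generic_eval L A (generic_series k L u) = A u.
Proof.
move=> A0; case: u => [|a u] uL; first by rewrite [LHS]mmap0 A0.
by rewrite /= insubT /generic_eval mmapX mmap1U enum_rankK.
Qed.

(** For the generic series the derivative of G^(n+1) is (n+1) G^n dG, which exhibits the quotient by
    n+1. The truncation length is that of [rcons w s]. *)
Lemma sh_pow_div_rcons n A w s : in_maxideal A ->
  sh_pow_div n.+1 n.+1 A (rcons w s) = sh (sh_pow n A) (deriv_last s A) w.
Proof.
move=> A0; pose L := (size w).+1; pose G := generic_series k L.
pose h : {rmorphism _ -> R} := generic_eval L A.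
have hG u : (size u <= L)%N -> h (G u) = A u by apply: generic_evalE.
rewrite (@sh_pow_div_lift _ h _ _ G A _ (sh (sh_pow n G) (deriv_last s G) w)) //.
- rewrite rmorph_sh; apply: sh_local => u uw.
    rewrite rmorph_sh_pow; apply: sh_pow_local => v vu; apply: hG.
    exact: leq_trans vu (leqW uw).
  by apply: hG; rewrite size_rcons.
- exact: mpoly_int_torsion_free.
- by rewrite factS dvdn_mulr.
- by move=> u; rewrite size_rcons; apply: hG.
- exact: sh_pow_rcons.
Qed.

(** Again by specialisation: (n+1) G^n dG divided by (n+1)! is (G^n/n!) dG. *)
Lemma sh_pow_fact_rcons n A w s : in_maxideal A ->
  sh_pow_div n.+1 n.+1`! A (rcons w s) =
    sh (sh_pow_div n n`! A) (deriv_last s A) w.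
Proof.
move=> A0; pose L := (size w).+1; pose G := generic_series k L.
pose h : {rmorphism _ -> R} := generic_eval L A.
have hG u : (size u <= L)%N -> h (G u) = A u by apply: generic_evalE.
rewrite (@sh_pow_div_lift _ h _ _ G A _
           (sh (sh_pow_div n n`! G) (deriv_last s G) w)) //.
- rewrite rmorph_sh; apply: sh_local => u uw.
    rewrite rmorph_sh_pow_div; apply: sh_pow_div_local => v vu; apply: hG.
    exact: leq_trans vu (leqW uw).
  by apply: hG; rewrite size_rcons.
- exact: mpoly_int_torsion_free.
- by move=> u; rewrite size_rcons; apply: hG.
rewrite sh_pow_rcons factS mulnC mulrnA; congr (_ *+ _).
rewrite !shE -sumrMnl; apply: eq_bigr => x _.
by rewrite (@sh_pow_divE _ _ n n`!) // mulr_natl mulrnAl.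
Qed.

Lemma sh_pow_div_nil n d A : in_maxideal A -> (d %| n.+1`!)%N ->
  sh_pow_div n.+1 d A [::] = 0.
Proof.
move=> A0 dn; pose G := generic_series k 0.
pose h : {rmorphism _ -> R} := generic_eval 0 A.
rewrite (@sh_pow_div_lift _ h _ _ G A _ 0) ?rmorph0 //.
- exact: mpoly_int_torsion_free.
- by move=> u uw; apply: generic_evalE.
by rewrite mul0rn [LHS]sh_nil mul0r.
Qed.

Lemma sh_pow_div00 A w : in_maxideal A -> sh_pow_div 0 0`! A w = sone w.
Proof. by move=> A0; rewrite -[LHS]mul1r -(@sh_pow_divE _ _ 0 1 A w). Qed.

End DividedPowers.

(** * Derivatives of exp_! and log_! *)

Section ExpLogDerivations.
Variables (R : comNzRingType) (k : nat).
Implicit Types (A B C : shuf R k) (w : word k) (s : 'I_k).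

Lemma shX_mul_small A C n w : A [::] = 0 -> (size w < n)%N -> (A ^+ n * C) w = 0.
Proof.
move=> A0 wn; have -> : (A ^+ n * C) w = (0 * C) w.
  apply: sh_local => // u uw; apply: shX_small => //; exact: leq_ltn_trans wn.
by rewrite mul0r.
Qed.

Lemma sh_pow_fact_small A n w : A [::] = 0 -> (size w < n)%N ->
  sh_pow_div n n`! A w = 0.
Proof.
move=> A0; elim: n w => // n IHn w; rewrite ltnS => wn.
case/lastP: w wn => [|w s] wn; first by rewrite sh_pow_div_nil.
rewrite size_rcons in wn; rewrite sh_pow_fact_rcons //.
have -> : sh (sh_pow_div n n`! A) (deriv_last s A) w = ((0 : shuf R k) * dlast s A) w.
  apply: sh_local => // u uw; apply: IHn; exact: leq_ltn_trans wn.
by rewrite mul0r.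
Qed.

(** On words of length below N, exp_! becomes one and the same finite sum in the shuffle algebra,
    since the later terms vanish there. *)
Lemma sh_exp_trunc A N w : A [::] = 0 -> (size w < N)%N ->
  sh_exp A w = (\sum_(0 <= n < N) (sh_pow_div n n`! A : shuf R k)) w.
Proof.
move=> A0 wN; rewrite shuf_sumE /sh_exp [RHS](big_cat_nat (n := (size w).+1)) //=.
rewrite [X in _ + X]big_nat_cond [X in _ + X]big1 ?addr0 // => n /andP[/andP[wn _] _].
exact: sh_pow_fact_small.
Qed.

Lemma sh_exp_nil A : A [::] = 0 -> sh_exp A [::] = 1.
Proof. by move=> A0; rewrite /sh_exp big_nat1 sh_pow_div00. Qed.

Lemma dlast_sh_exp A s : A [::] = 0 ->
  dlast s (sh_exp A) = (sh_exp A : shuf R k) * dlast s A.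
Proof.
move=> A0; apply: seriesP => w.
have -> : ((sh_exp A : shuf R k) * dlast s A) w =
    (\sum_(0 <= n < (size w).+1) (sh_pow_div n n`! A : shuf R k) * dlast s A) w.
  by rewrite -mulr_suml; apply: sh_local => // u uw; apply: sh_exp_trunc.
rewrite shuf_sumE /dlast /deriv_last /sh_exp size_rcons big_nat_recl // sh_pow_div00 //.
rewrite /sone -size_eq0 size_rcons add0r; apply: eq_bigr => n _.
exact: sh_pow_fact_rcons.
Qed.

(** The term of index n+1 has derivative (-1)^n (B-1)^n dB = (1-B)^n dB, which vanishes at [w] for n
    > |w|. *)
Lemma dlast_sh_logE B s w N : B [::] = 1 -> (size w < N)%N ->
  dlast s (sh_log B) w = (\sum_(0 <= n < N) (1 - B) ^+ n * dlast s B) w.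
Proof.
move=> B1 wN; have B0 : (1 - B) [::] = 0.
  by rewrite [LHS](_ : _ = 1 - B [::]) // B1 subrr.
rewrite shuf_sumE (big_cat_nat (n := (size w).+1)) //=.
rewrite [X in _ + X]big_nat_cond [X in _ + X]big1 ?addr0; last first.
  by move=> n /andP[/andP[wn _] _]; apply: shX_mul_small.
rewrite [LHS](_ : _ = sh_log B (rcons w s)) // /sh_log size_rcons big_add1.
apply: eq_bigr => n _.
rewrite sh_pow_div_rcons; last by rewrite /in_maxideal /ssub B1 subrr.
have -> : dlast s B = dlast s (B - 1).
  by rewrite (raddfB (dlast s)) /= dlast1 subr0.
have -> : (1 - B) ^+ n = (-1) ^+ n *: (B - 1) ^+ n.
  by rewrite -exprZn scaleN1r opprB.
by rewrite sh_powE !exprS !mulN1r opprK -scalerAl.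
Qed.

(** This is d(log_! B) = dB/B without division: B times the geometric sum in 1-B telescopes to 1 -
    (1-B)^N, and (1-B)^N vanishes on words shorter than N. *)
Lemma dlast_sh_log B s : B [::] = 1 -> B * dlast s (sh_log B) = dlast s B.
Proof.
move=> B1; apply: seriesP => w; set N := (size w).+1.
have B0 : (1 - B) [::] = 0 by rewrite [LHS](_ : _ = 1 - B [::]) // B1 subrr.
have -> : (B * dlast s (sh_log B)) w =
    (B * (\sum_(0 <= n < N) (1 - B) ^+ n * dlast s B)) w.
  by apply: sh_local => // u uw; apply: dlast_sh_logE.
have geom : B * \sum_(i < N) (1 - B) ^+ i = 1 - (1 - B) ^+ N.
  by apply: oppr_inj; rewrite opprB subrX1 addrAC subrr add0r mulNr.
rewrite -mulr_suml mulrA big_mkord geom mulrBl mul1r.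
rewrite [LHS](_ : _ = dlast s B w - ((1 - B) ^+ N * dlast s B) w) //.
by rewrite shX_mul_small ?subr0.
Qed.

Lemma sh_log_nil B : sh_log B [::] = 0.
Proof. by rewrite /sh_log big_geq. Qed.

Section Characteristic.
Variables (p : nat) (pcharRp : p \in [pchar R]).

Lemma shX_pchar B : B ^+ p = (B [::] ^+ p : R) *: 1.
Proof.
apply: dlast_eq => [|s].
  by rewrite shX_nil; apply: esym; apply: mulr1.
rewrite linearZ /= dlast1 scaler0 dlastX.
by apply: seriesP => w; rewrite shuf_mulrnE mulrn_pchar.
Qed.

(** As B^p = 1, the power B^(p-1) is the shuffle inverse of B. *)
Lemma dlast_sh_log_pchar B s : B [::] = 1 ->
  dlast s (sh_log B) = B ^+ p.-1 * dlast s B.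
Proof.
move=> B1; rewrite -[dlast s B]dlast_sh_log // mulrA -exprSr.
rewrite prednK ?prime_gt0 ?(pcharf_prime pcharRp) // shX_pchar B1 expr1n.
by rewrite scale1r mul1r.
Qed.

(** With E = exp_! A, the derivative of log_! E is E^(p-1) E dA = E^p dA = dA. *)
Lemma sh_expK A : A [::] = 0 -> sh_log (sh_exp A) = A.
Proof.
move=> A0; have E1 := sh_exp_nil A0.
apply: (@dlast_eq R k) => [|s]; first by rewrite sh_log_nil A0.
rewrite dlast_sh_log_pchar // dlast_sh_exp // mulrA -exprSr.
rewrite prednK ?prime_gt0 ?(pcharf_prime pcharRp) // shX_pchar E1 expr1n.
by rewrite scale1r mul1r.
Qed.

End Characteristic.

End ExpLogDerivations.

(** * Spans and recursive closures *)

Section Span.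
Variables (K : fieldType) (k : nat).
Implicit Types (A B : shuf K k) (w : word k).

Lemma spanE (I : Type) (F : I -> shuf K k) B :
  span F B <-> exists s : seq (K * I), B = \sum_(x <- s) x.1 *: F x.2.
Proof.
split=> -[s e]; exists s; last by move=> w; rewrite e shuf_sumE.
by apply: seriesP => w; rewrite shuf_sumE e.
Qed.

Lemma span0 (I : Type) (F : I -> shuf K k) : span F (0 : shuf K k).
Proof. by apply/spanE; exists [::]; rewrite big_nil. Qed.

Lemma spanD (I : Type) (F : I -> shuf K k) A B :
  span F A -> span F B -> span F (A + B).
Proof.
by move=> /spanE[s ->] /spanE[t ->]; apply/spanE; exists (s ++ t); rewrite big_cat.
Qed.

Lemma spanZ (I : Type) (F : I -> shuf K k) (c : K) A :
  span F A -> span F (c *: A).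
Proof.
move=> /spanE[s ->]; apply/spanE; exists [seq (c * x.1, x.2) | x <- s].
by rewrite big_map scaler_sumr; apply: eq_bigr => x _; rewrite scalerA.
Qed.

Lemma span_gen (I : Type) (F : I -> shuf K k) i : span F (F i).
Proof. by apply/spanE; exists [:: (1, i)]; rewrite big_seq1 scale1r. Qed.

Lemma span_sum (I J : Type) (F : I -> shuf K k) (r : seq J) (P : pred J)
    (G : J -> shuf K k) :
  (forall j, P j -> span F (G j)) -> span F (\sum_(j <- r | P j) G j).
Proof.
move=> FG; apply: (big_ind (fun A : shuf K k => span F A)) => //.
  exact: span0.
exact: spanD.
Qed.

Lemma span_linear_sub (I J : Type) (F : I -> shuf K k) (G : J -> shuf K k)
    (f : {linear shuf K k -> shuf K k}) A :
  span F A -> (forall i, span G (f (F i))) -> span G (f A).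
Proof.
move=> /spanE[s ->] FG; rewrite linear_sum; apply: span_sum => x _.
by rewrite linearZ; apply: spanZ.
Qed.

Lemma span_trans (I J : Type) (F : I -> shuf K k) (G : J -> shuf K k) A :
  span F A -> (forall i, span G (F i)) -> span G A.
Proof. exact: (@span_linear_sub _ _ _ _ idfun). Qed.

Lemma span_fin (I : finType) (F : I -> shuf K k) B :
  span F B <-> exists c : I -> K, B = \sum_i c i *: F i.
Proof.
split=> [/spanE[s ->]|[c ->]]; last first.
  by apply: span_sum => i _; apply/spanZ/span_gen.
exists (fun i => \sum_(x <- s | x.2 == i) x.1).
rewrite (partition_big (fun x : K * I => x.2) xpredT) //=; apply: eq_bigr => i _.
by rewrite scaler_suml; apply: eq_bigr => x /eqP->.
Qed.

(** With more than |I| vectors the coordinate matrix has a nonzero left kernel vector, which is a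
    linear relation among the [b i]. *)
Lemma independent_size (I : finType) m (b : 'I_m -> shuf K k) (c : I -> shuf K k) :
  independent b -> (forall i, span c (b i)) -> (m <= #|I|)%N.
Proof.
move=> ib bc; have /fin_all_exists[u ub] i := (span_fin _ _).1 (bc i).
pose M := \matrix_(i < m, j < #|I|) u i (enum_val j).
case: leqP => // Im; have : kermx M != 0.
  rewrite kermx_eq0; apply: contraTN Im => /eqP <-.
  by rewrite -leqNgt rank_leq_col.
case/rowV0Pn => v /sub_kermxP vM; case/eqP; apply/rowP => i; rewrite mxE.
move: i; apply: ib => w.
have -> : \sum_(i < m) v 0 i * b i w = (\sum_(i < m) v 0 i *: b i) w.
  by rewrite shuf_sumE.
under eq_bigr => i _ do rewrite ub scaler_sumr.
rewrite exchange_big big1 // => j _.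
under eq_bigr => i _ do rewrite scalerA.
rewrite -scaler_suml; have /rowP/(_ (enum_rank j)) := vM.
rewrite !mxE; under eq_bigr => i _ do rewrite mxE enum_rankK.
by move=> ->; rewrite scale0r.
Qed.

Lemma independent_extend m (b : 'I_m -> shuf K k) B :
    independent b -> ~ span b B ->
  independent (fun i : 'I_m.+1 => oapp b B (unlift ord0 i)).
Proof.
move=> ib bB c c0.
have cE w : c ord0 * B w + (\sum_(i < m) c (lift ord0 i) *: b i) w = 0.
  rewrite -(c0 w) big_ord_recl unlift_none /= shuf_sumE; congr (_ + _).
  by apply: eq_bigr => i _; rewrite liftK.
have c00 : c ord0 = 0.
  apply/eqP/negP => /negP nz; apply: bB; apply/span_fin.
  exists (fun i => - (c ord0)^-1 * c (lift ord0 i)); apply: seriesP => w.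
  under eq_bigr => i _ do rewrite -scalerA.
  rewrite -scaler_sumr; apply: (mulfI nz).
  rewrite [RHS](_ : _ = c ord0 *
    (- (c ord0)^-1 * (\sum_(i < m) c (lift ord0 i) *: b i) w)) //.
  by rewrite mulrA mulrN divff // mulN1r; apply/eqP; rewrite -addr_eq0 cE.
move=> i; case: (unliftP ord0 i) => [j|] -> //.
apply: (ib (fun j => c (lift ord0 j))) => w.
by have := cE w; rewrite c00 mul0r add0r shuf_sumE.
Qed.

(** An independent family inside V grows one vector at a time until it spans V; [independent_size]
    stops the growth at |I|. *)
Lemma has_dim_sub (I : finType) (V : shuf K k -> Prop) (c : I -> shuf K k) :
    (forall n (b : 'I_n -> shuf K k) B, (forall i, V (b i)) -> span b B -> V B) ->
    (forall B, V B -> span c B) ->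
  exists2 d, has_dim V d & (d <= #|I|)%N.
Proof.
move=> Vlin Vc.
have step m : (exists d, has_dim V d) \/
    (exists b : 'I_m -> shuf K k, independent b /\ forall i, V (b i)).
  elim: m => [|m [|[b [ib Vb]]]]; [|by left|].
    by right; exists (fun=> 0); split=> [c0 _|] [].
  have [Vsub|] := pselect (forall B, V B -> span b B).
    by left; exists m, b; split=> // B; split; [apply: Vsub | apply: Vlin].
  move/existsNP=> [B /not_implyP[VB nB]]; right.
  exists (fun i : 'I_m.+1 => oapp b B (unlift ord0 i)).
  by split=> [|i]; [apply: independent_extend | case: (unlift ord0 i)].
have [[d Vd]|[b [ib Vb]]] := step #|I|.+1.
  exists d => //; have [b [ib Vb]] := Vd.
  apply: independent_size ib _ => i; apply/Vc/Vb; exact: span_gen.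
by have := independent_size ib (fun i => Vc _ (Vb i)); rewrite ltnn.
Qed.

(** For finite I this is a linear representation (weighted automaton): the coordinates of the
    derivatives are the entries of the letter matrices. *)
Definition stable (I : Type) (b : I -> shuf K k) :=
  forall i s, span b (dlast s (b i)).

Lemma stable_span (I : Type) (b : I -> shuf K k) A s :
  stable b -> span b A -> span b (dlast s A).
Proof. by move=> sb bA; apply: span_linear_sub bA _ => i; apply: sb. Qed.

(** The letters of T are deleted one by one from its end, so the recursive closure is the closure
    under last-letter derivatives. *)
Lemma rho_cons (T : word k) s (A : series K k) :
  rho (s :: T) A = dlast s (rho T A).
Proof. by apply: seriesP => w; rewrite /rho /dlast /deriv_last cat_rcons. Qed.

Lemma rec_closure_refl A : rec_closure A A.
Proof.
rewrite {2}(_ : A = rho [::] A); first exact: span_gen.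
by apply: seriesP => w; rewrite /rho cats0.
Qed.

Lemma rec_closure_dlast A B s : rec_closure A B -> rec_closure A (dlast s B).
Proof.
move=> AB; apply: span_linear_sub AB _ => T /=; rewrite -rho_cons; exact: span_gen.
Qed.

Lemma stable_rec_closure (I : Type) (b : I -> shuf K k) A B :
  stable b -> span b A -> rec_closure A B -> span b B.
Proof.
move=> sb bA AB; apply: span_trans AB _ => T /=.
elim: T => [|s T IHT].
  by rewrite (_ : rho [::] A = A) //; apply: seriesP => w; rewrite /rho cats0.
rewrite rho_cons.
exact: stable_span.
Qed.

(** Reduces each dimension bound to exhibiting and counting a stable family, which may be linearly
    dependent. *)
Lemma stable_has_dim (I : finType) (b : I -> shuf K k) A :
  stable b -> span b A -> exists2 d, has_dim (rec_closure A) d & (d <= #|I|)%N.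
Proof.
move=> sb bA; apply: (@has_dim_sub _ _ b) => [n c B Ac cB|B].
  exact: span_trans cB Ac.
exact: stable_rec_closure.
Qed.

Lemma has_dim_stable A d : has_dim (rec_closure A) d ->
  exists b : 'I_d -> shuf K k, stable b /\ span b A.
Proof.
move=> [b [_ bA]]; exists b; split; last exact/bA/rec_closure_refl.
by move=> i s; apply/bA/rec_closure_dlast/bA/span_gen.
Qed.

(** Finite dimension of the closure, phrased without bases so that closure properties only require
    listing generators. *)
Definition recognizable A :=
  exists (I : finType) (b : I -> shuf K k), stable b /\ span b A.

End Span.

(** * Closures of exp_! and log_! in characteristic p *)

Section ShuffleProducts.
Variables (K : fieldType) (k : nat).
Implicit Types (A B : shuf K k) (s : 'I_k).

Lemma span_mul (I J L : Type) (F : I -> shuf K k) (G : J -> shuf K k)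
    (H : L -> shuf K k) A B :
    span F A -> span G B -> (forall i j, span H (F i * G j)) ->
  span H (A * B).
Proof.
move=> /spanE[r ->] /spanE[t ->] FG; rewrite mulr_suml; apply: span_sum => x _.
rewrite mulr_sumr; apply: span_sum => y _.
by rewrite -scalerAl -scalerAr; do 2!apply: spanZ.
Qed.

Variables (I : finType) (b : I -> shuf K k).
Hypothesis b_stable : stable b.

(** Indexing by ordered tuples gives |I|^n products, the source of d^p in the bound for log_!. *)
Definition tprod n (t : n.-tuple I) : shuf K k := \prod_(i <- t) b i.

Lemma span_tprod_mul n A B :
  span b A -> span (@tprod n) B -> span (@tprod n.+1) (A * B).
Proof.
move=> bA tB; apply: span_mul bA tB _ => i t.
have -> : b i * tprod t = tprod [tuple of i :: t] by rewrite /tprod big_cons.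
exact: span_gen.
Qed.

Lemma span_tprod_exp n A : span b A -> span (@tprod n) (A ^+ n).
Proof.
move=> bA; elim: n => [|n IHn]; last by rewrite exprS; apply: span_tprod_mul.
have -> : A ^+ 0 = tprod [tuple] by rewrite /tprod big_nil.
exact: span_gen.
Qed.

(** The Leibniz rule replaces one factor by its derivative, again a combination of the [b i]. *)
Lemma tprod_stable n : stable (@tprod n).
Proof.
elim: n => [|n IHn] t s.
  by rewrite /tprod tuple0 big_nil dlast1; apply: span0.
case/tupleP: t => i t; rewrite {2}/tprod big_cons dlastM.
apply: spanD; apply: span_tprod_mul => //; last exact: IHn.
- exact: span_gen.
- exact: span_gen.
Qed.

Section Characteristic.
Variables (p : nat) (pcharKp : p \in [pchar K]).
Let p_gt0 : (0 < p)%N := prime_gt0 (pcharf_prime pcharKp).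

(** The index [None] stands for log_! B itself and accounts for the summand 1 in 1 + d^p. *)
Definition log_family B (t : option (p.-tuple I)) : shuf K k :=
  oapp (@tprod p) (sh_log B) t.

Lemma sh_log_stable B : B [::] = 1 -> span b B ->
  stable (log_family B) /\ span (log_family B) (sh_log B).
Proof.
move=> B1 bB; have tsub A : span (@tprod p) A -> span (log_family B) A.
  move=> tA; apply: span_trans tA _ => t; exact: (span_gen (log_family B) (Some t)).
split; last exact: (span_gen (log_family B) None).
case=> [t|] s; apply: tsub; first exact: tprod_stable.
rewrite /= (dlast_sh_log_pchar pcharKp) // mulrC -(prednK p_gt0).
apply: span_tprod_mul; last exact: span_tprod_exp.
exact: stable_span.
Qed.

Definition monomial (e : {ffun I -> 'I_p}) : shuf K k := \prod_i b i ^+ e i.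

(* In characteristic p, the p-th shuffle power of b i is a constant, so       *)
(* exponents can be reduced modulo p.                                         *)
Lemma span_monomial (f : I -> nat) : span monomial (\prod_i b i ^+ f i).
Proof.
pose e := [ffun i => Ordinal (ltn_pmod (f i) p_gt0)].
have -> : \prod_i b i ^+ f i =
    \prod_i ((b i [::] ^+ p : K) ^+ (f i %/ p) *: b i ^+ e i).
  apply: eq_bigr => i _; rewrite ffunE /= {1}(divn_eq (f i) p) exprD mulnC.
  by rewrite exprM (shX_pchar pcharKp) exprZn expr1n -scalerAl mul1r.
by rewrite scaler_prod; apply/spanZ/(span_gen monomial e).
Qed.

Lemma span_monomial_prod (r : seq I) : span monomial (\prod_(i <- r) b i).
Proof.
have -> : \prod_(i <- r) b i = \prod_i b i ^+ count_mem i r.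
  elim: r => [|j r IHr]; first by rewrite big_nil big1.
  rewrite big_cons IHr; under [RHS]eq_bigr => i _ do rewrite exprD.
  rewrite big_split; congr (_ * _); rewrite (bigD1 j) //= eqxx big1 ?mulr1 //.
  by move=> i; rewrite eq_sym => /negbTE->.
exact: span_monomial.
Qed.

(** As a plain product, a monomial gets its derivative from [tprod_stable]. *)
Lemma monomial_prod e : exists r : seq I, monomial e = \prod_(i <- r) b i.
Proof.
exists (flatten [seq nseq (e i) i | i <- index_enum I]).
rewrite big_flatten big_map; apply: eq_bigr => i _.
by rewrite big_nseq iter_mulr_1.
Qed.

Lemma monomial_dlast e s : span monomial (dlast s (monomial e)).
Proof.
have [r ->] := monomial_prod e.
apply: span_trans (tprod_stable (in_tuple r) s) _ => t.
exact: span_monomial_prod.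
Qed.

Definition exp_family A (e : {ffun I -> 'I_p}) : shuf K k :=
  (sh_exp A : shuf K k) * monomial e.

(** With E = exp_! A, the derivative of E m is E (dA m + dm). Both dA m and dm are combinations of
    products of the [b i], hence of monomials with exponents below p. *)
Lemma sh_exp_stable A : A [::] = 0 -> span b A ->
  stable (exp_family A) /\ span (exp_family A) (sh_exp A).
Proof.
move=> A0 bA; have mulE X : span monomial X ->
    span (exp_family A) ((sh_exp A : shuf K k) * X).
  (* To fit [span_mul], the factor [sh_exp A] is viewed as a family with the single index [tt]. *)
  move=> mX; apply: (span_mul (F := fun=> sh_exp A)) mX _.
    exact: (span_gen (fun=> sh_exp A) tt).
  by move=> _ e; apply: (span_gen (exp_family A) e).
split=> [e s|]; last first.
  rewrite -[X in span _ X](mulr1 (sh_exp A : shuf K k)); apply: mulE.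
  by have := span_monomial_prod [::]; rewrite big_nil.
rewrite dlastM dlast_sh_exp // -mulrA -mulrDr; apply: mulE.
apply: spanD; last exact: monomial_dlast.
have [r ->] := monomial_prod e.
have bdA : span b (dlast s A) by apply: stable_span.
apply: (span_mul (G := fun=> \prod_(i <- r) b i) bdA).
  exact: (span_gen (fun=> \prod_(i <- r) b i) tt).
by move=> i _; have := span_monomial_prod (i :: r); rewrite big_cons.
Qed.

End Characteristic.
End ShuffleProducts.

(** * Rational series are recognizable *)

Definition conc (R : comNzRingType) (k : nat) : Type := series R k.

Section ConcatenationRing.
Variables (R : comNzRingType) (k : nat).
Implicit Types (A B C P : conc R k) (w : word k) (s : 'I_k).

HB.instance Definition _ := GRing.Zmodule.copy (conc R k) (word k -> R).

Lemma smul_nil A B : smul A B [::] = A [::] * B [::].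
Proof. by rewrite /smul big_ord1. Qed.

(** Only the cut after the last letter leaves B the empty word. In the resulting Leibniz rule dA is
    weighted by the constant term of B. *)
Lemma smul_rcons A B w s :
  smul A B (rcons w s) = smul A (deriv_last s B) w + A (rcons w s) * B [::].
Proof.
rewrite /smul size_rcons big_ord_recr /= take_oversize ?drop_oversize ?size_rcons //.
congr (_ + _); apply: eq_bigr => i _.
have iw : (i <= size w)%N by rewrite -ltnS.
by rewrite /deriv_last drop_rcons // -cats1 takel_cat.
Qed.

Fact smulDl : left_distributive (@smul R k : conc R k -> conc R k -> conc R k) +%R.
Proof.
move=> A B C; apply: seriesP => w.
rewrite [RHS](_ : _ = smul A C w + smul B C w) // /smul -big_split.
apply: eq_bigr => i _; exact: mulrDl.
Qed.

Fact smulDr : right_distributive (@smul R k : conc R k -> conc R k -> conc R k) +%R.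
Proof.
move=> A B C; apply: seriesP => w.
rewrite [RHS](_ : _ = smul A B w + smul A C w) // /smul -big_split.
apply: eq_bigr => i _; exact: mulrDr.
Qed.

Lemma smul_scaler A (c : R) B w : smul A (fun u => B u * c) w = smul A B w * c.
Proof. by rewrite /smul mulr_suml; apply: eq_bigr => i _; rewrite mulrA. Qed.

Fact smulA : associative (@smul R k : conc R k -> conc R k -> conc R k).
Proof.
move=> A B C; apply: seriesP => w; elim/last_ind: w A B C => [|w s IHw] A B C.
  by rewrite !smul_nil mulrA.
rewrite smul_rcons [RHS]smul_rcons smul_nil.
have -> : deriv_last s (smul B C) =
    (smul B (deriv_last s C) : conc R k) + (fun w => deriv_last s B w * C [::]).
  by apply: seriesP => u; apply: smul_rcons.
rewrite smulDr [X in X + _ = _](_ : _ = smul A (smul B (deriv_last s C)) w +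
  smul A (fun w => deriv_last s B w * C [::]) w) //.
by rewrite IHw smul_scaler -addrA smul_rcons mulrDl mulrA.
Qed.

Fact smul1 : left_id (sone : conc R k) (@smul R k).
Proof.
move=> A; apply: seriesP => w; elim/last_ind: w A => [|w s IHw] A.
  by rewrite smul_nil /sone eqxx mul1r.
by rewrite smul_rcons IHw /sone -size_eq0 size_rcons mul0r addr0.
Qed.

Lemma smul0r A w : smul A (fun=> 0) w = 0.
Proof. by rewrite /smul big1 // => i _; rewrite mulr0. Qed.

Fact smulr1 : right_id (sone : conc R k) (@smul R k).
Proof.
move=> A; apply: seriesP => w; case/lastP: w => [|w s].
  by rewrite smul_nil /sone eqxx mulr1.
have d0 : deriv_last s (sone : conc R k) = fun=> 0.
  by apply: seriesP => u; rewrite /deriv_last /sone -size_eq0 size_rcons.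
by rewrite smul_rcons d0 smul0r /sone eqxx mulr1 add0r.
Qed.

Fact smul_one_neq0 : (sone : conc R k) != 0.
Proof.
apply/eqP => /(congr1 (fun A : conc R k => A [::])) /eqP.
by rewrite /sone eqxx (oner_eq0 R).
Qed.

HB.instance Definition _ := GRing.Zmodule_isNzRing.Build (conc R k)
  smulA smul1 smulr1 smulDl smulDr smul_one_neq0.

Lemma smul_local A A' B w :
  (forall u, (size u <= size w)%N -> A u = A' u) -> smul A B w = smul A' B w.
Proof.
move=> eA; apply: eq_bigr => i _; rewrite eA // size_take_min; exact: geq_minr.
Qed.

Lemma smul_local_r A B B' w :
  (forall u, (size u <= size w)%N -> B u = B' u) -> smul A B w = smul A B' w.
Proof.
move=> eB; apply: eq_bigr => i _; rewrite eB // size_drop; exact: leq_subr.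
Qed.

Lemma conc_sumE (I : Type) (r : seq I) (Q : pred I) (F : I -> conc R k) w :
  (\sum_(i <- r | Q i) F i) w = \sum_(i <- r | Q i) F i w.
Proof. exact: (big_morph (fun A : conc R k => A w)). Qed.

Lemma concX_small P n w : P [::] = 0 -> (size w < n)%N -> (P ^+ n) w = 0.
Proof.
move=> P0; elim: n w => // n IHn w; rewrite ltnS => wn.
rewrite exprSr; apply: big1 => i _.
have [iw|wi] := ltnP i (size w); last by rewrite drop_oversize // P0 mulr0.
rewrite IHn ?mul0r // size_take_min.
exact: leq_ltn_trans (geq_minl _ _) (leq_trans iw wn).
Qed.

(** P^n vanishes on words shorter than n, so the geometric series at [w] equals its partial sum up
    to n = |w|. Two-sidedness is what [rational_inv] asks for. *)
Lemma conc_geometric P : P [::] = 0 ->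
  exists Q, (1 - P) * Q = 1 /\ Q * (1 - P) = 1.
Proof.
move=> P0; pose S N : conc R k := \sum_(i < N) P ^+ i.
pose Q : conc R k := fun w => S (size w).+1 w; exists Q.
have QS w u : (size u <= size w)%N -> Q u = S (size w).+1 u.
  move=> uw; rewrite /Q /S !conc_sumE -!(big_mkord xpredT (fun i => (P ^+ i) u)).
  rewrite [RHS](big_cat_nat (n := (size u).+1)) //= [X in _ + X]big_nat_cond.
  rewrite [X in _ + X]big1 ?addr0 // => i /andP[/andP[ui _] _].
  exact: concX_small.
have S1 w : ((1 : conc R k) - P ^+ (size w).+1) w = (1 : conc R k) w.
  rewrite [LHS](_ : _ = (1 : conc R k) w - (P ^+ (size w).+1) w) //.
  by rewrite concX_small ?subr0.
have SE n : (1 - P) * S n = 1 - P ^+ n.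
  by apply: oppr_inj; rewrite opprB subrX1 -mulNr opprB.
have SC n : S n * (1 - P) = (1 - P) * S n.
  apply/esym/commr_sum => i _; apply/commr_sym/commrB; first exact: commr1.
  exact/commr_sym/commrX.
split; apply: seriesP => w; rewrite -[RHS]S1 -SE.
  exact/smul_local_r/QS.
rewrite -SC; exact/smul_local/QS.
Qed.

Lemma conc_mul_nil A B : (A * B) [::] = A [::] * B [::] :> R.
Proof. exact: smul_nil. Qed.

End ConcatenationRing.

Section Rationality.
Variables (K : fieldType) (k : nat).
Implicit Types (A B : shuf K k) (w : word k) (s : 'I_k).

Lemma smul_linear (A : series K k) :
  linear (smul A : shuf K k -> shuf K k).
Proof.
move=> c B C; apply: seriesP => w.
rewrite [RHS](_ : _ = c * smul A B w + smul A C w) // mulr_sumr -big_split.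
apply: eq_bigr => i _.
rewrite [LHS](_ : _ = A (take i w) * (c * B (drop i w) + C (drop i w))) //.
by rewrite mulrDr mulrCA.
Qed.

HB.instance Definition _ (A : series K k) :=
  GRing.isLinear.Build K (shuf K k) (shuf K k) _ (smul A : shuf K k -> shuf K k)
    (smul_linear A).

Lemma span_smul (I J : Type) (F : I -> shuf K k) (G : J -> shuf K k)
    (A : series K k) B :
  span F B -> (forall i, span G (smul A (F i))) -> span G (smul A B).
Proof. exact: (@span_linear_sub K k I J F G (smul A : shuf K k -> shuf K k)). Qed.

Lemma dlast_smul A B s :
  dlast s (smul A B) = (smul A (dlast s B) : shuf K k) + B [::] *: dlast s A.
Proof.
apply: seriesP => w; rewrite [LHS]smul_rcons mulrC.
by [].
Qed.

Lemma recognizable_add A B :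
  recognizable A -> recognizable B -> recognizable (A + B).
Proof.
move=> [I [a [sa aA]]] [J [b [sb bB]]].
pose c (x : I + J) := match x with inl i => a i | inr j => b j end.
have cl X : span a X -> span c X.
  by move=> aX; apply: span_trans aX _ => i; apply: (span_gen c (inl i)).
have cr X : span b X -> span c X.
  by move=> bX; apply: span_trans bX _ => j; apply: (span_gen c (inr j)).
exists (I + J)%type, c; split; last by apply: spanD; auto.
by case=> i s; [apply/cl/sa | apply/cr/sb].
Qed.

(** The [a i] and the products A b_j form a stable family, because d(A b_j) = A db_j + b_j(1) dA. *)
Lemma recognizable_smul A B :
  recognizable A -> recognizable B -> recognizable (smul A B : shuf K k).
Proof.
move=> [I [a [sa aA]]] [J [b [sb bB]]].
pose c (x : I + J) : shuf K k := match x with inl i => a i | inr j => smul A (b j) end.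
have cl X : span a X -> span c X.
  by move=> aX; apply: span_trans aX _ => i; apply: (span_gen c (inl i)).
have cr X : span b X -> span c (smul A X).
  by move=> bX; apply: span_smul bX _ => j; apply: (span_gen c (inr j)).
exists (I + J)%type, c; split; last exact: cr.
case=> i s; first by apply/cl/sa.
rewrite dlast_smul; apply: spanD; first exact/cr/sb.
exact/spanZ/cl/stable_span.
Qed.

(** Differentiating BA = 1 gives A(1) dB = -B dA, where AB = 1 forces A(1) to be nonzero. So B and
    the products B a_i form a stable family. *)
Lemma recognizable_inv A B : recognizable A ->
  smul A B = sone -> smul B A = sone -> recognizable B.
Proof.
move=> [I [a [sa aA]]] AB BA.
have dB s : dlast s B = - (A [::])^-1 *: (smul B (dlast s A) : shuf K k).
  have A0 : A [::] != 0.
    apply/eqP => A0; have /eqP := congr1 (fun C : series K k => C [::]) AB.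
    by rewrite smul_nil A0 mul0r /sone eqxx eq_sym oner_eq0.
  have /eqP : dlast s (smul B A) = 0 by rewrite BA; apply: dlast1.
  rewrite dlast_smul addr_eq0 => /eqP ->.
  by rewrite scaleNr scalerN opprK scalerA mulVf // scale1r.
pose c (x : option I) : shuf K k := oapp (fun i => smul B (a i)) B x.
have cs X : span a X -> span c (smul B X).
  by move=> aX; apply: span_smul aX _ => i; apply: (span_gen c (Some i)).
have cd s : span c (dlast s B) by rewrite dB; apply/spanZ/cs/stable_span.
exists (option I), c; split; last exact: (span_gen c None).
case=> [i|] s //=; rewrite dlast_smul; apply: spanD; first exact/cs/sa.
exact: spanZ.
Qed.

(** Deleting a last letter sends the indicator of a word to an indicator or to 0, so the indicators
    of words of bounded length form a stable family. *)
Lemma recognizable_finite A : finite_support A -> recognizable A.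
Proof.
move=> [r rA]; pose L := \max_(u <- r) size u.
pose delta (u : L.-bseq 'I_k) : shuf K k := fun w => (w == u)%:R.
exists {: L.-bseq 'I_k}, delta; split=> [u s|].
  move uE : (bseqval u) => v0; case/lastP: v0 uE => [|v t] uE.
    rewrite (_ : dlast s (delta u) = 0); first exact: span0.
    apply: seriesP => w; rewrite /dlast /deriv_last /delta uE.
    by rewrite -size_eq0 size_rcons.
  have vL : (size v <= L)%N.
    by have := size_bseq u; rewrite uE size_rcons; apply: ltnW.
  rewrite (_ : dlast s (delta u) = (s == t)%:R *: delta (Bseq vL)).
    exact/spanZ/span_gen.
  apply: seriesP => w; rewrite /dlast /deriv_last /delta uE eqseq_rcons.
  by rewrite [RHS](_ : _ = (s == t)%:R * (w == v)%:R) // -natrM mulnb andbC.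
apply/span_fin; exists (fun u : L.-bseq 'I_k => A u).
apply: seriesP => w; rewrite shuf_sumE.
have [wL|Lw] := leqP (size w) L.
  rewrite (bigD1 (Bseq wL)) //= big1 ?addr0 => [|u uw].
    by rewrite [RHS](_ : _ = A w * (w == w)%:R) // eqxx mulr1.
  rewrite [LHS](_ : _ = A u * (w == u)%:R) //; case: eqP => [wu|]; rewrite ?mulr0 //.
  by case/eqP: uw; apply/val_inj.
rewrite rA ?big1 // => [u _|].
  rewrite [LHS](_ : _ = A u * (w == u)%:R) //; case: eqP => [wu|]; rewrite ?mulr0 //.
  by have := size_bseq u; rewrite -wu leqNgt Lw.
apply: contraTN Lw => wr; rewrite -leqNgt /L.
by rewrite (big_rem w) //= leq_maxl.
Qed.

Lemma rational_recognizable A : rational A -> recognizable A.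
Proof.
elim=> {A} [A|A B _ rA _ rB|c A _ [I [b [sb bA]]]|A B _ rA _ rB|A B _ rA AB BA].
- exact: recognizable_finite.
- exact: (recognizable_add rA rB).
- by exists I, b; split=> //; apply: (spanZ c bA).
- exact: recognizable_smul.
- exact: (recognizable_inv rA (seriesP AB) (seriesP BA)).
Qed.

End Rationality.

(** * Recognizable series are rational *)

Section Kleene.
Variables (R : comNzRingType) (k : nat).
Implicit Types (A B P : conc R k) (w : word k) (s : 'I_k).

Lemma rational0 : rational (0 : conc R k).
Proof. by apply: rational_poly; exists [::]. Qed.

Lemma rational1 : rational (1 : conc R k).
Proof.
apply: rational_poly; exists [:: [::]] => w; rewrite inE => /negbTE w0.
by rewrite [LHS](_ : _ = (w == [::])%:R) // w0.
Qed.

Lemma rationalD A B : rational A -> rational B -> rational (A + B).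
Proof. exact: rational_add. Qed.

Lemma rationalM A B : rational A -> rational B -> rational (A * B).
Proof. exact: rational_mul. Qed.

Lemma rational_sum (I : Type) (r : seq I) (Q : pred I) (F : I -> conc R k) :
  (forall i, Q i -> rational (F i)) -> rational (\sum_(i <- r | Q i) F i).
Proof.
move=> rF; apply: (big_ind (fun A : conc R k => rational A)) => //.
  exact: rational0.
exact: rationalD.
Qed.

Lemma rational_geometric P : rational P -> P [::] = 0 ->
  exists Q : conc R k, [/\ rational Q, (1 - P) * Q = 1 & Q * (1 - P) = 1].
Proof.
move=> rP /conc_geometric[Q [PQ QP]]; exists Q; split; [|exact: PQ|exact: QP].
apply: (@rational_inv _ _ (1 - P)).
- apply: rationalD; first exact: rational1.
  have -> : - P = sscale (-1) P by apply: seriesP => w; rewrite /sscale mulN1r.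
  exact: rational_scale.
- by move=> w; rewrite -[RHS](congr1 (fun A : conc R k => A w) PQ).
- by move=> w; rewrite -[RHS](congr1 (fun A : conc R k => A w) QP).
Qed.

(* Gaussian elimination of the unknown b ord0 from the linear system. *)
Lemma rational_system n (b c : 'I_n -> conc R k) (P : 'I_n -> 'I_n -> conc R k) :
    (forall i, rational (c i)) -> (forall i j, rational (P i j)) ->
    (forall i j, P i j [::] = 0) ->
    (forall i, b i = c i + \sum_j b j * P i j) ->
  forall i, rational (b i).
Proof.
elim: n b c P => [|n IHn] b c P rc rP P0 bE; first by case.
have [Q [rQ PQ QP]] := rational_geometric (rP ord0 ord0) (P0 ord0 ord0).
pose j0 (j : 'I_n) := lift ord0 j.
(* Solves b_0 (1 - P_00) = c_0 + sum_j b_j P_0j by right multiplication with Q, the inverse of 1 -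
   P_00. *)
have b0E : b ord0 = c ord0 * Q + \sum_j b (j0 j) * (P ord0 (j0 j) * Q).
  have {}bE := bE ord0; rewrite big_ord_recl in bE.
  rewrite -[LHS]mulr1 -PQ mulrA mulrBr mulr1 {1}bE addrCA addrAC subrr add0r.
  by rewrite mulrDl mulr_suml; under eq_bigr => j _ do rewrite -mulrA.
(* After substitution the new coefficients P_ij + P_0j Q P_i0 still have no constant term, because
   P_0j has none. *)
have rb j : rational (b (j0 j)).
  move: j; apply: (IHn (b \o j0) (fun i => c (j0 i) + c ord0 * (Q * P (j0 i) ord0))
      (fun i j => P (j0 i) (j0 j) + P ord0 (j0 j) * (Q * P (j0 i) ord0))).
  - by move=> i; apply: rationalD => //; do 2!apply: rationalM => //.
  - by move=> i j; apply: rationalD => //; do 2!apply: rationalM => //.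
  - move=> i j; rewrite [LHS](_ : _ = P (j0 i) (j0 j) [::] +
      (P ord0 (j0 j) * (Q * P (j0 i) ord0)) [::]) //.
    by rewrite conc_mul_nil !P0 mul0r addr0.
  move=> i /=; rewrite bE big_ord_recl b0E mulrDl mulr_suml -[c ord0 * Q * _]mulrA.
  rewrite addrA [X in X + _ = _]addrA -[LHS]addrA; congr (_ + _).
  rewrite -big_split; apply: eq_bigr => j _.
  by rewrite mulrDr addrC !mulrA.
move=> i; case: (unliftP ord0 i) => [j|] -> //.
rewrite b0E; apply: rationalD; first exact: rationalM.
by apply: rational_sum => j _; do 2!apply: rationalM => //.
Qed.

End Kleene.

Section RecognizableRational.
Variables (K : fieldType) (k : nat).
Implicit Types (A B : shuf K k).

(** Splitting off the last letter gives the system b_i = b_i(1) + sum_j b_j P_ij, whose P_ij = sum_s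
    M_isj X_s are linear forms in the letters. *)
Lemma stable_rational n (b : 'I_n -> shuf K k) i : stable b -> rational (b i).
Proof.
move=> sb; have {sb} cf j : exists M : 'I_k -> 'I_n -> K,
    forall s, dlast s (b j) = \sum_l M s l *: b l.
  exact: (fin_all_exists (fun s => (span_fin b (dlast s (b j))).1 (sb j s))).
have {cf}[M bM] := fin_all_exists cf.
pose P i j : conc K k := fun w => if w is [:: s] then M i s j else 0.
pose c i : conc K k := fun w => if w is [::] then b i [::] else 0.
apply: (@rational_system _ _ n b c P) => // {i}.
- by move=> i; apply: rational_poly; exists [:: [::]] => -[].
- move=> i j; apply: rational_poly; exists [seq [:: s] | s <- enum 'I_k] => w wP.
  case: w wP => [|s [|t w]] //; rewrite map_f ?mem_enum //.
move=> i; apply: seriesP => w.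
rewrite [RHS](_ : _ = c i w + (\sum_j (b j : conc K k) * P i j) w) // conc_sumE.
case/lastP: w => [|w s].
  by rewrite big1 ?addr0 // => j _; rewrite conc_mul_nil mulr0.
rewrite [c _ _](_ : _ = 0) ?add0r; last by case: w.
rewrite [LHS](_ : _ = dlast s (b i) w) // bM shuf_sumE; apply: eq_bigr => j _.
rewrite [RHS]smul_rcons (_ : P i j [::] = 0) // mulr0 addr0.
have -> : deriv_last s (P i j) = fun w => sone w * M i s j.
  apply: seriesP => -[|t [|? ?]]; rewrite /deriv_last /sone /=.
  - by rewrite mul1r.
  - by rewrite mul0r.
  - by rewrite mul0r.
by rewrite smul_scaler smulr1 mulrC.
Qed.

Lemma recognizable_rational A : recognizable A -> rational A.
Proof.
(* A basis of the closure replaces [b], since [stable_rational] wants a family indexed by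
   ordinals. *)
move=> [I [b [sb bA]]]; have [d hd _] := stable_has_dim sb bA.
have [c [sc /span_fin[u ->]]] := has_dim_stable hd.
apply: rational_sum => i _.
have -> : u i *: c i = sscale (u i) (c i) by [].
exact/rational_scale/stable_rational.
Qed.

Lemma rational_has_dim A :
  rational A -> exists d, has_dim (rec_closure A) d.
Proof.
move=> /rational_recognizable[I [b [sb bA]]].
by have [d hd _] := stable_has_dim sb bA; exists d.
Qed.

End RecognizableRational.

(** * Coefficients in finite fields *)

Section FiniteSubfield.
Variables (K : fieldType) (r : seq K).

Definition in_seq : pred K := fun x => x \in r.
(** Finiteness is transported from [seq_sub r]; the field operations are inherited from K under
    [r_closed]. *)
Definition seq_field := {x : K | in_seq x}.

HB.instance Definition _ := [isSub of seq_field for sval].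
HB.instance Definition _ := [Choice of seq_field by <:].

Definition seq_field_enc (x : seq_field) : seq_sub r := SeqSub (valP x).
Definition seq_field_dec (x : seq_sub r) : seq_field := exist _ (ssval x) (ssvalP x).

Fact seq_field_encK : cancel seq_field_enc seq_field_dec.
Proof. by move=> x; apply: val_inj. Qed.

HB.instance Definition _ : isCountable seq_field := CanIsCountable seq_field_encK.
HB.instance Definition _ : isFinite seq_field := CanIsFinite seq_field_encK.

Hypothesis r_closed : divring_closed in_seq.

#[local] HB.instance Definition _ := GRing.isDivringClosed.Build K in_seq r_closed.
#[local] HB.instance Definition _ := [SubChoice_isSubIntegralDomain of seq_field by <:].
#[local] HB.instance Definition _ := [SubIntegralDomain_isSubField of seq_field by <:].

Lemma finite_subfield :
  exists (F : finFieldType) (f : {rmorphism F -> K}),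
    forall x, x \in r -> exists c, x = f c.
Proof.
exists (seq_field : finFieldType), (val : {rmorphism seq_field -> K}) => x xr.
by exists (exist _ x xr : seq_field).
Qed.

End FiniteSubfield.

Lemma roots_in_seq (K : fieldType) (P : {poly K}) : P != 0 ->
  exists r : seq K, forall x, root P x -> x \in r.
Proof.
have [n] := ubnP (size P); elim: n P => // n IHn P; rewrite ltnS => Pn P0.
have [[x Px]|nP] := pselect (exists x, root P x); last first.
  by exists [::] => x Px; case: nP; exists x.
have /factor_theorem[Q PQ] := Px.
have Q0 : Q != 0 by apply: contraNneq P0 => Q0; rewrite PQ Q0 mul0r.
have [|r rQ] := IHn Q _ Q0.
  by apply: leq_trans Pn; rewrite PQ size_Mmonic ?monicXsubC // size_XsubC addn2.
exists (x :: r) => y; rewrite PQ rootM root_XsubC inE => /orP[/rQ->|->] //.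
by rewrite orbT.
Qed.

Section AlgebraicOverFp.
Variables (p : nat) (p_pr : prime p) (L : closedFieldType).
Variables (phi : {rmorphism 'F_p -> L}) (L_alg : forall z : L, algebraicOver phi z).
Variables (K : fieldType) (iota : {rmorphism K -> L}).

Lemma pchar_subfield : p \in [pchar K].
Proof. by rewrite -(fmorph_pchar iota) (rmorph_pchar phi) // pchar_Fp. Qed.

Lemma exprp_inj e : injective (fun x : K => x ^+ (p ^ e)).
Proof.
elim: e => [|e IHe] x y //=; rewrite !expnS !exprM => /IHe exy.
exact: (fmorph_inj (pFrobenius_aut pchar_subfield)).
Qed.

(* The iterates x^(p^i) all lie in the finite space of values at x of         *)
(* polynomials over F_p of degree less than that of a polynomial killing x.   *)
Lemma exprp_periodic (x : K) : exists2 e, (0 < e)%N & x ^+ (p ^ e) = x.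
Proof.
have [P P0 Px] := L_alg (iota x); pose d := size P.
pose R i : {poly 'F_p} := 'X^(p ^ i) %% P.
have Rx i : (map_poly phi (R i)).[iota x] = iota (x ^+ (p ^ i)).
  have /(congr1 (fun Q => (map_poly phi Q).[iota x])) := divp_eq 'X^(p ^ i) P.
  rewrite rmorphD rmorphM /= hornerD hornerM (rootP Px) mulr0 add0r => <-.
  by rewrite map_polyXn hornerXn rmorphXn.
(* Pigeonhole: there is one more index than there are row vectors of length d over F_p. *)
pose g (i : 'I_#|{: 'rV['F_p]_d}|.+1) : 'rV['F_p]_d := poly_rV (R i).
have /injectivePn[i [j ij gij]] : ~~ injectiveb g.
  by apply/injectiveP => /leq_card; rewrite card_ord ltnn.
have Rd l : (size (R l) <= d)%N by rewrite ltnW // ltn_modp.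
have {gij} : R i = R j.
  by rewrite -(poly_rV_K (Rd i)) -(poly_rV_K (Rd j)); congr rVpoly.
move/(congr1 (fun Q => (map_poly phi Q).[iota x])); rewrite !Rx => /fmorph_inj.
wlog ltij : i j {ij} / (i < j)%N => [hw|e].
  by case: (ltngtP i j) ij => // [/hw|/hw ji _ /esym/ji|/val_inj->] //; rewrite eqxx.
exists (j - i)%N; first by rewrite subn_gt0.
(* It suffices that x^(p^(j-i)) and x have the same p^i-th power. *)
apply: (@exprp_inj i); rewrite /= e -exprM -expnD subnK //; exact: ltnW.
Qed.

Lemma exprp_period_mul (x : K) e f : x ^+ (p ^ e) = x -> x ^+ (p ^ (e * f)) = x.
Proof.
move=> xe; elim: f => [|f IHf]; first by rewrite muln0.
by rewrite mulnS expnD exprM xe.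
Qed.

Lemma exprp_common_period (s : seq K) :
  exists2 e, (0 < e)%N & {in s, forall x, x ^+ (p ^ e) = x}.
Proof.
elim: s => [|x s [e e0 es]]; first by exists 1%N.
have [f f0 fx] := exprp_periodic x; exists (e * f)%N; first by rewrite muln_gt0 e0.
move=> y; rewrite inE => /predU1P[->|/es/exprp_period_mul //].
by rewrite mulnC exprp_period_mul.
Qed.

Lemma exprpD e (x y : K) : (x + y) ^+ (p ^ e) = x ^+ (p ^ e) + y ^+ (p ^ e).
Proof. by apply: exprDn_pchar; rewrite pnatX pnatE // pchar_subfield. Qed.

(** The fixed points of x^(p^e) form a subfield because this power map is additive and
    multiplicative. They are finitely many, as roots of X^(p^e) - X, which is nonzero since e >
    0. *)
Lemma finite_subfield_seq (s : seq K) :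
  exists e (F : finFieldType) (f : {rmorphism F -> K}),
    {in s, forall x, x ^+ (p ^ e) = x} /\
    forall x, x ^+ (p ^ e) = x -> exists c, x = f c.
Proof.
have [e e0 es] := exprp_common_period s; exists e.
have q1 : (1 < p ^ e)%N by rewrite -(exp1n e) ltn_exp2r // prime_gt1.
have P0 : 'X^(p ^ e) - 'X != 0 :> {poly K}.
  by rewrite -size_poly_gt0 size_polyDl ?size_polyXn // size_polyN size_polyX.
have [r0 rP] := roots_in_seq P0; pose r := [seq x <- r0 | x ^+ (p ^ e) == x].
have rE x : (x \in r) = (x ^+ (p ^ e) == x).
  rewrite mem_filter andb_idr // => /eqP ex; apply: rP.
  by rewrite /root !hornerE ex subrr.
have r_closed : divring_closed (in_seq r).
  have rF x : (x \in in_seq r) = (x ^+ (p ^ e) == x) by exact: rE.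
  split=> [|x y|x y]; rewrite !rF ?expr1n // => /eqP xe /eqP ye.
    by rewrite exprpD exprNn_pchar ?pnatX ?pnatE ?pchar_subfield // xe ye.
  by rewrite exprMn exprVn xe ye.
have [F [f fr]] := finite_subfield r_closed; exists F, f; split=> // x /eqP.
by rewrite -rE; apply: fr.
Qed.

End AlgebraicOverFp.

(** For a stable family, b_i(w X_s) = sum_l M_isl b_l(w). Every coefficient thus arises by sums and
    products, without inversion, from the letter matrices, the constant terms and the coordinates of
    A. *)
Lemma rational_coefs (K : fieldType) (k : nat) (A : series K k) : rational A ->
  exists s : seq K, forall P : K -> Prop,
    P 0 -> (forall x y, P x -> P y -> P (x + y)) ->
    (forall x y, P x -> P y -> P (x * y)) -> {in s, forall x, P x} ->
  forall w, P (A w).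
Proof.
move=> /rational_has_dim[d /has_dim_stable[b [sb /span_fin[u uE]]]].
have /fin_all_exists[M bM] j : exists M : 'I_k -> 'I_d -> K,
    forall s, dlast s (b j) = \sum_l M s l *: b l.
  exact: (fin_all_exists (fun s => (span_fin b (dlast s (b j))).1 (sb j s))).
exists (codom u ++ codom (fun i => b i [::]) ++
        codom (fun x : 'I_d * 'I_k * 'I_d => M x.1.1 x.1.2 x.2)) => P P0 PD PM Ps.
have Psum (F : 'I_d -> K) : (forall i, P (F i)) -> P (\sum_i F i).
  by move=> PF; apply: big_ind.
have Pb w : forall i, P (b i w).
  elim/last_ind: w => [|w s IHw] i.
    by apply: Ps; rewrite !mem_cat codom_f orbT.
  rewrite [b i _](_ : _ = dlast s (b i) w) // bM shuf_sumE; apply: Psum => l.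
  apply: (PM (M i s l)) (IHw l); apply: Ps.
  by rewrite !mem_cat (codom_f _ (i, s, l)) !orbT.
move=> w; rewrite uE shuf_sumE; apply: Psum => i; apply: (PM (u i)) (Pb w i).
by apply: Ps; rewrite mem_cat codom_f.
Qed.

Theorem theorem10p1 (p : nat) (p_pr : prime p)
    (* L is an algebraic closure of F_p and K is a subfield of L *)
    (L : closedFieldType) (phi : {rmorphism 'F_p -> L})
    (L_alg : forall z : L, algebraicOver phi z)
    (K : fieldType) (iota : {rmorphism K -> L}) (k : nat) :
  (forall A : series K k, in_maxideal A ->
     (rational A <-> rational (sh_exp A)))
  /\
  (forall A : series K k, in_maxideal A -> rational A ->
     (exists d d' : nat,
        has_dim (rec_closure (sadd sone A)) d /\
        has_dim (rec_closure (sh_log (sadd sone A))) d' /\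
        (d' <= 1 + d ^ p)%N)
     /\
     (exists (F : finFieldType) (f : {rmorphism F -> K}),
        forall w, exists c, A w = f c)
     /\
     (forall (F : finFieldType) (f : {rmorphism F -> K}) (e : nat),
        #|F| = (p ^ e)%N -> (forall w, exists c, A w = f c) ->
        exists d d' : nat,
          has_dim (rec_closure A) d /\
          has_dim (rec_closure (sh_exp A)) d' /\
          (d' <= p ^ ((p ^ e) ^ d))%N)).
Proof.
have pK := pchar_subfield p_pr phi iota.
have exp_rec (A : series K k) : in_maxideal A -> rational A -> rational (sh_exp A).
  move=> A0 /rational_recognizable[I [b [sb bA]]].
  have [sE EE] := sh_exp_stable sb pK A0 bA.
  by apply: recognizable_rational; exists {ffun I -> 'I_p}, (exp_family b A).
have log_rec (B : series K k) : B [::] = 1 -> rational B -> rational (sh_log B).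
  move=> B1 /rational_recognizable[I [b [sb bB]]].
  have [sL LL] := sh_log_stable sb pK B1 bB.
  by apply: recognizable_rational; exists (option (p.-tuple I)), (log_family b B).
split=> [A A0|A A0 rA].
  split=> [|rE]; first exact: exp_rec.
  (* A is recovered as log_! of exp_! A, whose constant term is 1. *)
  rewrite -(sh_expK pK A0); apply: log_rec rE; exact: sh_exp_nil.
have r1A : rational (sadd sone A) by apply: rational_add rA; apply: rational1.
split.
  have [d dA] := rational_has_dim r1A; have [b [sb bA]] := has_dim_stable dA.
  have B1 : sadd sone A [::] = 1 by rewrite /sadd /sone eqxx A0 addr0.
  have [sL LL] := sh_log_stable sb pK B1 bA.
  have [d' dL] := stable_has_dim sL LL.
  by rewrite card_option card_tuple card_ord => dd; exists d, d'.
split.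
  have [s sP] := rational_coefs rA.
  have [e [F [f [es ef]]]] := finite_subfield_seq p_pr L_alg iota s.
  exists F, f => w; apply/ef/(sP (fun x => x ^+ (p ^ e) = x)) => //.
  - by rewrite expr0n -leqn0 leqNgt expn_gt0 prime_gt0.
  - by move=> x y xe ye; rewrite (exprpD p_pr phi iota) xe ye.
  - by move=> x y xe ye; rewrite exprMn xe ye.
move=> F f e cF _; have [d dA] := rational_has_dim rA.
have [b [sb bA]] := has_dim_stable dA.
have [sE EE] := sh_exp_stable sb pK A0 bA.
have [d' dE] := stable_has_dim sE EE.
rewrite card_ffun !card_ord => dd; exists d, d'; split=> //; split=> //.
(* The bound obtained is p^d, and d < q^d because q = |F| is at least 2. *)
apply: leq_trans dd _; rewrite leq_pexp2l ?prime_gt0 //.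
by rewrite ltnW // ltn_expl // -cF card_finNzRing_gt1.
Qed.
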